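(* Let $(\Xi,d)$, $c$, $\mathcal F$ satisfy the general assumptions (1)–(3) of the context, let $P$ be a probability distribution on $\Xi$, and assume $\rho_{\mathrm{crit}}>0$. Then there exists $\lambda_{\mathrm{low}}>0$ such that the following holds. Let $\delta\in(0,1)$ and set $$\alpha = 48\Big(\|\mathcal F\|_\infty+\frac1{\lambda_{\mathrm{low}}}\Big)\Big(\mathcal I_{\mathcal F}+\frac{2}{\lambda_{\mathrm{low}}}\Big)+\frac{2\|\mathcal F\|_\infty}{\lambda_{\mathrm{low}}}\sqrt{2\log\frac2\delta},\qquad \beta=\frac{96\,\mathcal I_{\mathcal F}}{\lambda_{\mathrm{low}}}+\frac{4\|\mathcal F\|_\infty}{\lambda_{\mathrm{low}}}\sqrt{2\log\frac4\delta}.$$ If $n>\frac{16(\alpha+\beta)^2}{\rho_{\mathrm{crit}}^2}$ and $\rho>\frac{\alpha}{\sqrt n}$, then with probability at least $1-\delta$ (over the i.i.d. samples $\xi_1,\dots,\xi_n\sim P$), $$\widehat R_\rho(f)\;\ge\;\mathbb E_{\xi\sim P}[f(\xi)]\qquad\text{for all } f\in\mathcal F.$$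
   Context: $(\Xi,d)$ is a metric space, $\mathcal F$ is a family of functions $f:\Xi\to\mathbb R$, $c:\Xi\times\Xi\to\mathbb R$ is a cost function. General assumptions: (1) $(\Xi,d)$ is compact. (2) $c$ is jointly continuous with respect to $d$, non-negative, and $c(\xi,\zeta)=0$ if and only if $\xi=\zeta$. (3) Every $f\in\mathcal F$ is continuous, $(\mathcal F,\|\cdot\|_\infty)$ is compact, and Dudley's entropy $\mathcal I_{\mathcal F}:=\int_0^\infty\sqrt{\log N(t,\mathcal F,\|\cdot\|_\infty)}\,dt$ is finite, where $N(t,\mathcal F,\|\cdot\|_\infty)$ is the $t$-packing number of $\mathcal F$ (maximal number of functions in $\mathcal F$ that are pairwise at distance at least $t$). Notation: $\|f\|_\infty=\sup_{\Xi}|f|$ and $\|\mathcal F\|_\infty=\sup_{f\in\mathcal F}\|f\|_\infty$. $\mathcal P(\Xi)$ is the set of (Borel) probability measures on $\Xi$; for $\pi\in\mathcal P(\Xi\times\Xi)$, $[\pi]_1,[\pi]_2$ are its marginals. $W_c(Q,Q')=\inf\{\mathbb E_{(\xi,\zeta)\sim\pi}[c(\xi,\zeta)]:\pi\in\mathcal P(\Xi\times\Xi),[\pi]_1=Q,[\pi]_2=Q'\}$. For $\rho>0$, $R_{\rho,Q}(f)=\sup\{\mathbb E_{\xi\sim Q'}[f(\xi)]: Q'\in\mathcal P(\Xi), W_c(Q,Q')\le\rho\}$. With $\xi_1,\dots,\xi_n$ i.i.d. from $P$ and $\widehat P_n=\frac1n\sum_{i=1}^n\delta_{\xi_i}$,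 set $\widehat R_\rho(f)=R_{\rho,\widehat P_n}(f)$. The critical radius is $$\rho_{\mathrm{crit}}=\inf_{f\in\mathcal F}\mathbb E_{\xi\sim P}\big[\min\{c(\xi,\zeta):\zeta\in\operatorname{arg\,max}_\Xi f\}\big].$$ *)

(* Defs.v *)
From HB Require Import structures.
From mathcomp Require Import all_boot all_order all_algebra.
From mathcomp Require Import all_classical all_reals all_analysis.
Import Order.TTheory GRing.Theory Num.Theory.
Import numFieldNormedType.Exports.

Set Implicit Arguments.
Unset Strict Implicit.
Unset Printing Implicit Defensive.

Local Open Scope classical_set_scope.
Local Open Scope ring_scope.

(* A [measurableType] must be pointed, while a [metricType] need not be. A
   space carrying a probability measure is nonempty, so asking for a
   distinguished point loses no generality. *)
#[short(type="pmetricType")]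
HB.structure Definition PointedMetric (R : numDomainType) :=
  {M of Metric R M & Pointed M}.

Notation borel T := (g_sigma_algebraType (@open T)).

Definition supnorm (T : Type) (R : realType) (f : T -> R) : R :=
  sup [set `|f x| | x in [set: T]].

Definition supnorm_family (T : Type) (R : realType) (F : set (T -> R)) : R :=
  sup [set supnorm f | f in F].

Definition packing_number (T : Type) (R : realType) (F : set (T -> R)) (t : R)
    : \bar R :=
  ereal_sup [set (n%:R%:E : \bar R) | n in [set n : nat | exists S,
    [/\ S `<=` F, (S #= `I_n)%card &
        forall f g, S f -> S g -> f <> g -> t <= supnorm (f \- g)]]].

(* [x `^ 2^-1] is the square root of [x >= 0] in the extended reals. *)
Definition dudley_entropy (T : Type) (R : realType) (F : set (T -> R))
    : \bar R :=
  (\int[lebesgue_measure]_(t in `]0%R, +oo[)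
     (lne (packing_number F t) `^ 2^-1))%E.

Section optimal_transport.
Context (R : realType) (T : pmetricType R).

(* The plans are Borel measures for the product topology. *)
Definition couplings (Q Q' : {measure set (borel T) -> \bar R}) :
    set (probability (borel (T * T)%type) R) :=
  [set pi | (forall A : set (borel T), measurable A ->
               pi (fst @^-1` A) = Q A) /\
            (forall A : set (borel T), measurable A ->
               pi (snd @^-1` A) = Q' A)].

Definition transport_cost (c : T * T -> R)
    (Q Q' : {measure set (borel T) -> \bar R}) : \bar R :=
  ereal_inf [set (\int[pi]_z (c z)%:E)%E | pi in couplings Q Q'].

Definition robust_risk (c : T * T -> R) (rho : R)
    (Q : {measure set (borel T) -> \bar R}) (f : T -> R) : \bar R :=
  ereal_sup [set (\int[Q']_x (f x)%:E)%E |
    Q' in [set Q' : probability (borel T) R |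
            (transport_cost c Q Q' <= rho%:E)%E]].

Definition argmax (f : T -> R) : set T := [set z | forall y, f y <= f z].

(* The infimum over [argmax f] is a minimum when [f] and [c] are continuous
   and [T] is compact. *)
Definition critical_radius (c : T * T -> R) (F : set (T -> R))
    (P : probability (borel T) R) : \bar R :=
  ereal_inf [set (\int[P]_x (inf [set c (x, z) | z in argmax f])%:E)%E |
    f in F].

End optimal_transport.

Section empirical_measure.
Local Open Scope ereal_scope.
Context (R : realType) (T : pmetricType R) (n : nat) (xi : 'I_n -> T).

Definition empirical (A : set (borel T)) : \bar R :=
  (n%:R^-1)%:E * \sum_(i < n) \d_(xi i : borel T) A.

Let empirical0 : empirical set0 = 0.
Proof. by rewrite /empirical big1 ?mule0. Qed.

Let empirical_ge0 A : 0 <= empirical A.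
Proof. by rewrite mule_ge0 ?lee_fin// sume_ge0. Qed.

Let empirical_sigma_additive : semi_sigma_additive empirical.
Proof.
have n0 : (0 <= n%:R^-1 :> R)%R by [].
pose m k : {measure set (borel T) -> \bar R} :=
  \d_(nth point (codom xi) k : borel T).
suff -> : empirical = mscale (NngNum n0) (msum m n).
  exact: measure_semi_sigma_additive.
apply/funext => A; rewrite /empirical /mscale /msum /m /=; congr (_ * _).
apply: eq_bigr => i _; rewrite codomE (nth_map i) ?size_enum_ord//.
by rewrite nth_ord_enum.
Qed.

HB.instance Definition _ := isMeasure.Build _ _ _ empirical
  empirical0 empirical_ge0 empirical_sigma_additive.

End empirical_measure.

Definition iid_samples (R : realType) (T : pmetricType R)
    (d : measure_display) (Omega : measurableType d) (Pr : probability Omega R)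
    (P : probability (borel T) R) (n : nat) (X : 'I_n -> {RV Pr >-> borel T}) :=
  (forall i (A : set (borel T)), measurable A ->
     distribution Pr (X i) A = P A) /\
  (forall A : 'I_n -> set (borel T), (forall i, measurable (A i)) ->
     Pr (\bigcap_i (X i @^-1` A i)) = (\prod_(i < n) Pr (X i @^-1` A i))%E).

(* The event [E] is only asked to contain a measurable event of probability at
   least [p]; for a measurable [E] this is [p%:E <= Pr E]. *)
Definition with_probability_at_least (R : realType) (d : measure_display)
    (Omega : measurableType d) (Pr : probability Omega R) (p : R)
    (E : set Omega) :=
  exists A : set Omega, [/\ measurable A, A `<=` E & (p%:E <= Pr A)%E].

(* Main.v *)
(* The constant lambda_low may be chosen after F, c and P, so alpha
   dominates any prescribed multiple of 1 + sqrt (log (2 / delta)); no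
   duality is needed.

   Let C be an upper bound of c. Moving a fraction theta = min (1, rho / C)
   of each atom of the empirical measure to a point z costs at most rho,
   hence the robust risk of f is at least (1 - theta) * (empirical mean of
   f) + theta * f z. If the mean of f under P were equal to max f, then P
   would be carried by argmax f and the transport cost of P to argmax f
   would vanish; as rho_crit > 0 and F is compact, there is kappa > 0 such
   that every f in F has a point z with f z >= (mean of f) + kappa. The gain
   rho * kappa / C beats the deviation between the mean and the empirical
   mean as soon as the latter is at most (kappa / C) * alpha / sqrt n for
   all f in F at once.

   This uniform deviation is bounded by chaining: maximal packings of F at
   the scales M / 2^k are nets, the increments along the chain are
   controlled by Hoeffding's inequality and a union bound, and the
   thresholds are summable because the entropy integral is finite. The good
   event is a countable intersection of measurable events. *)
Require Import Defs.
From HB Require Import structures.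
From mathcomp Require Import all_boot all_order all_algebra.
From mathcomp Require Import all_classical all_reals all_analysis.
From mathcomp Require Import measurable_realfun ring lra.
Import Order.TTheory GRing.Theory Num.Theory.
Import numFieldNormedType.Exports.
Set Implicit Arguments.
Unset Strict Implicit.
Unset Printing Implicit Defensive.
Local Open Scope classical_set_scope.
Local Open Scope ring_scope.

(** Made for centred variables: after integration the linear term vanishes and a sub-Gaussian bound
    remains. For [x > 1] already [x <= 2 * x ^+ 2]; for [x <= 1] the quadratic bound
    [1 + x + 2 * x ^+ 2] lies in between. *)
Lemma expR_le_add_expR_sqr (R : realType) (x : R) :
  expR x <= x + expR (2 * x ^+ 2).
Proof.
have [x1|x1] := lerP x 1; last first.
  rewrite (@le_trans _ _ (expR (2 * x ^+ 2)))//; last by rewrite lerDr; lra.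
  by rewrite ler_expR; nra.
have h : 0 < 1 - x / 2 by lra.
have e1 : 1 - x / 2 <= expR (- (x / 2)).
  by rewrite (le_trans _ (expR_ge1Dx _)).
have e2 : (1 - x / 2) ^+ 2 * expR x <= 1.
  have -> : expR x = expR (x / 2) ^+ 2.
    by rewrite -expRM_natl; congr expR; lra.
  rewrite -exprMn exprn_ile1//; first by rewrite mulr_ge0// ?expR_ge0// ltW.
  rewrite -[leRHS](@expRxMexpNx_1 _ (x / 2)) mulrC ler_wpM2l// expR_ge0.
(* The right side minus 1 is a quarter of [x ^+ 2 * ((1 - x) * (5 - 2 * x))]. *)
have e3 : 1 <= (1 - x / 2) ^+ 2 * (1 + x + 2 * x ^+ 2).
  suff : 0 <= x ^+ 2 * ((1 - x) * (5 - 2 * x)) by nra.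
  by rewrite mulr_ge0 ?sqr_ge0// mulr_ge0; lra.
have e4 : expR x <= 1 + x + 2 * x ^+ 2.
  rewrite -(@ler_pM2l _ ((1 - x / 2) ^+ 2)) ?exprn_gt0//.
  exact: le_trans e2 e3.
have := expR_ge1Dx (2 * x ^+ 2); lra.
Qed.


(** * Bounded functions of independent samples *)

Section product_expectation.
Local Open Scope ereal_scope.
Context {R : realType} {d d' : measure_display} {W : measurableType d}
  {U : measurableType d'} (Pr : probability W R).

Import HBNNSimple.

Let ge0_integral_mul_nnsfun (V : W -> R) (Y : W -> U) (C : \bar R)
    (u : {nnsfun U >-> R}) :
  measurable_fun setT V -> (forall w, 0 <= V w)%R -> measurable_fun setT Y ->
  0 <= C ->
  (forall A : set U, measurable A ->
    \int[Pr]_w (V w * \1_A (Y w))%:E = C * \int[Pr]_w (\1_A (Y w))%:E) ->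
  \int[Pr]_w (V w * u (Y w))%:E = C * \int[Pr]_w (u (Y w))%:E.
Proof.
move=> mV V0 mY C0 CA.
pose A r : set U := u @^-1` [set r].
have mA r : measurable (A r) by exact: measurable_sfunP.
have m1 r : measurable_fun setT (fun w => \1_(A r) (Y w) : R).
  by apply: (measurableT_comp _ mY); exact: measurable_indic.
have m2 r : measurable_fun setT (fun w => r * \1_(A r) (Y w))%R.
  by apply: measurable_funM; [exact: measurable_cst|exact: m1].
have nn r x : (0 <= r * \1_(A r) x :> R)%R.
  by have := nnfun_muleindic_ge0 u r x; rewrite -EFinM lee_fin.
have nnV r w : (0 <= V w * (r * \1_(A r) (Y w)))%R by rewrite mulr_ge0.
transitivity (\sum_(r \in range u) \int[Pr]_w (V w * (r * \1_(A r) (Y w)))%:E).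
  under eq_integral => w _ do rewrite fimfunE mulr_fsumr -fsumEFin//.
  rewrite ge0_integral_fsum// => [r|r w _]; last by rewrite lee_fin.
  by apply/measurable_EFinP; apply: measurable_funM.
transitivity (C * \sum_(r \in range u) \int[Pr]_w (r * \1_(A r) (Y w))%:E);
    last first.
  congr (C * _).
  under [in RHS]eq_integral => w _ do rewrite fimfunE -fsumEFin//.
  rewrite ge0_integral_fsum// => [r|r w _]; last by rewrite lee_fin nn.
  by apply/measurable_EFinP; exact: m2.
rewrite ge0_mule_fsumr; last first.
  by move=> r; apply: integral_ge0 => w _; rewrite lee_fin nn.
apply: eq_fsbigr => r /set_mem[y _ <-{r}].
under eq_integral do rewrite mulrCA EFinM.
under [in RHS]eq_integral do rewrite EFinM.
rewrite !ge0_integralZl_EFin//; first by rewrite CA// muleCA.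
- by apply/measurable_EFinP.
- by move=> w _; rewrite lee_fin mulr_ge0.
- by apply/measurable_EFinP; exact: measurable_funM.
Qed.

(** Factorisation on indicators extends to simple functions by their level sets, then to [u] by
    monotone convergence. Below, [V] is the product over the remaining coordinates. *)
Lemma ge0_integral_mul_indep (V : W -> R) (Y : W -> U) (C : \bar R)
    (u : U -> R) :
  measurable_fun setT V -> (forall w, 0 <= V w)%R -> measurable_fun setT Y ->
  C \is a fin_num -> 0 <= C -> measurable_fun setT u -> (forall x, 0 <= u x)%R ->
  (forall A : set U, measurable A ->
    \int[Pr]_w (V w * \1_A (Y w))%:E = C * \int[Pr]_w (\1_A (Y w))%:E) ->
  \int[Pr]_w (V w * u (Y w))%:E = C * \int[Pr]_w (u (Y w))%:E.
Proof.
move=> mV V0 mY Cfin C0 mu u0 CA.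
have mEu : measurable_fun setT (EFin \o u) by exact/measurable_EFinP.
pose u_ := nnsfun_approx measurableT mEu.
have mu_ n : measurable_fun setT (fun w => u_ n (Y w)).
  exact: measurableT_comp.
have nd x m n : (m <= n)%N -> (u_ m x <= u_ n x)%R.
  by move=> mn; exact/lefP/nd_nnsfun_approx.
have cu x : (u_ n x)%:E @[n --> \oo] --> (u x)%:E.
  by apply: (@cvg_nnsfun_approx _ _ _ _ measurableT _ mEu) => // z _;
    rewrite lee_fin.
transitivity (limn (fun n => \int[Pr]_w (V w * u_ n (Y w))%:E)).
  rewrite -monotone_convergence//.
  - apply: eq_integral => w _; apply/esym/cvg_lim => //.
    under eq_fun do rewrite EFinM.
    by rewrite EFinM; apply: cvgeZl => //; exact: cu.
  - by move=> n; apply/measurable_EFinP; exact: measurable_funM.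
  - by move=> n w _; rewrite lee_fin mulr_ge0.
  - by move=> w _ m n mn; rewrite lee_fin ler_wpM2l// nd.
under eq_fun do rewrite (ge0_integral_mul_nnsfun _ mV V0 mY C0 CA).
have mono : {homo (fun n => \int[Pr]_w (u_ n (Y w))%:E) :
    m n / (m <= n)%N >-> m <= n}.
  move=> m n mn; apply: ge0_le_integral => //.
  - by move=> w _; rewrite lee_fin.
  - by apply/measurable_EFinP.
  - by apply/measurable_EFinP.
  - by move=> w _; rewrite lee_fin nd.
rewrite limeMl//; last exact: ereal_nondecreasing_is_cvgn.
congr (_ * _); rewrite -monotone_convergence//.
- by apply: eq_integral => w _; apply/cvg_lim => //; exact: cu.
- by move=> n; apply/measurable_EFinP.
- by move=> n w _; rewrite lee_fin.
- by move=> w _ m n mn; rewrite lee_fin nd.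
Qed.

Lemma ge0_integral_prod_indep (n : nat) (X : 'I_n -> {RV Pr >-> U})
    (u : 'I_n -> U -> R) :
  (forall A : 'I_n -> set U, (forall i, measurable (A i)) ->
     Pr (\bigcap_i (X i @^-1` A i)) = \prod_(i < n) Pr (X i @^-1` A i)) ->
  (forall i, measurable_fun setT (u i)) -> (forall i x, 0 <= u i x)%R ->
  (forall i, \int[Pr]_w (u i (X i w))%:E \is a fin_num) ->
  \int[Pr]_w (\prod_(i < n) u i (X i w))%:E =
    \prod_(i < n) \int[Pr]_w (u i (X i w))%:E.
Proof.
move=> indep mu u0 ufin.
(* Indicators are replaced by arbitrary functions one coordinate at a time. *)
suff H k (v : 'I_n -> U -> R) : (k <= n)%N ->
    (forall i, measurable_fun setT (v i)) -> (forall i x, 0 <= v i x)%R ->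
    (forall i, \int[Pr]_w (v i (X i w))%:E \is a fin_num) ->
    (forall i : 'I_n, (k <= i)%N -> exists2 A, measurable A & v i = \1_A) ->
    \int[Pr]_w (\prod_(i < n) v i (X i w))%:E =
    \prod_(i < n) \int[Pr]_w (v i (X i w))%:E.
  by apply: (H n) => // i; rewrite leqNgt ltn_ord.
have mX i : measurable_fun setT (X i) by [].
have int1 i (A : set U) : measurable A ->
    \int[Pr]_w (\1_A (X i w))%:E = Pr (X i @^-1` A).
  move=> mA; have mXA : measurable (X i @^-1` A).
    by rewrite -[X in measurable X]setTI; exact: mX.
  by rewrite -[X in Pr X]setIT -integral_indic.
(* For [k = 0] all factors are indicators and the claim is the independence hypothesis. *)
elim: k v => [|k IH] v kn mv v0 vfin vA.
  have /choice[A HA] : forall i, exists A, measurable A /\ v i = \1_A.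
    by move=> i; have [A mA vE] := vA i isT; exists A.
  have mA i : measurable (A i) by case: (HA i).
  have vE i : v i = \1_(A i) by case: (HA i).
  under [RHS]eq_bigr do rewrite vE int1//.
  rewrite -indep// -[X in Pr X]setIT -integral_indic//; last first.
    apply: fin_bigcap_measurable => // i _.
    by rewrite -[X in measurable X]setTI; exact: mX.
  apply: eq_integral => w _; congr EFin.
  under eq_bigr do rewrite vE.
  have [wA|wA] := boolP (w \in \bigcap_i (X i @^-1` A i)).
    rewrite [RHS]indicE wA big1// => i _.
    by rewrite indicE mem_set//; move: wA => /set_mem; apply.
  rewrite [RHS]indicE (negbTE wA).
  have [i nAi] : exists i, ~ A i (X i w).
    apply/existsNP => h; move/negP: wA; apply; apply/mem_set => i _; exact: h.
  by rewrite (bigD1 i)//= indicE memNset// mul0r.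
pose i0 := Ordinal kn.
pose V w := (\prod_(i < n | i != i0) v i (X i w))%R.
pose C := \prod_(i < n | i != i0) \int[Pr]_w (v i (X i w))%:E.
rewrite [RHS](bigD1 i0)//= muleC -/C.
under eq_integral => w _ do rewrite (bigD1 i0)//= mulrC -/(V w).
have mvX i : measurable_fun setT (fun w => v i (X i w)).
  exact: measurableT_comp (mv i) (mX i).
apply: ge0_integral_mul_indep => //.
- rewrite /V; under eq_fun do rewrite big_mkcond.
  by apply: measurable_prod => i _; case: (i != i0).
- by move=> w; apply: prodr_ge0.
- by apply: prode_fin_num.
- by apply: prode_ge0 => i _; apply: integral_ge0 => w _; rewrite lee_fin.
move=> A mA.
(* With an indicator put back at coordinate [k], the induction hypothesis applies. *)
pose v' i := if i == i0 then \1_A else v i.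
have v'i0 : v' i0 = \1_A by rewrite /v' eqxx.
have v'i i : i != i0 -> v' i = v i by rewrite /v' => /negbTE ->.
have -> : C = \prod_(i < n | i != i0) \int[Pr]_w (v' i (X i w))%:E.
  by apply: eq_bigr => i /v'i ->.
rewrite -v'i0 muleC.
transitivity (\prod_(i < n) \int[Pr]_w (v' i (X i w))%:E); last first.
  by rewrite (bigD1 i0).
rewrite -IH ?(ltnW kn)//.
- apply: eq_integral => w _; rewrite [in RHS](bigD1 i0)//= mulrC; congr EFin.
  by congr (_ * _)%R; apply: eq_bigr => i /v'i ->.
- by move=> i; rewrite /v'; case: ifP => // _; exact: measurable_indic.
- by move=> i x; rewrite /v'; case: ifP => // _; exact: v0.
- move=> i; rewrite /v'; case: ifP => // _.
  by rewrite int1// fin_num_measure// -[X in measurable X]setTI; exact: mX.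
- move=> i ki; rewrite /v'; case: ifPn => [_|ii0]; first by exists A.
  apply: vA; rewrite ltn_neqAle ki andbT.
  by apply: contraNneq ii0 => kE; apply/eqP/val_inj.
Qed.

End product_expectation.

Section bounded_expectation.
Context {R : realType} {d : measure_display} {U : measurableType d}
  (P : probability U R).
Implicit Types (f g : U -> R) (b : R).

Lemma Rintegral_cst_probability b : \int[P]_x b = b.
Proof.
rewrite Rintegral_cst// [X in fine X](_ : _ = 1%E) ?mulr1//.
exact: probability_setT.
Qed.

Lemma integrable_bounded f b : measurable_fun setT f ->
  (forall x, `|f x| <= b) -> P.-integrable setT (EFin \o f).
Proof.
move=> mf fb; apply: measurable_bounded_integrable => //.
  by rewrite ltey_eq fin_num_measure.
exists b; split; first exact: num_real.
by move=> c bc x _ /=; rewrite (le_trans (fb x))// ltW.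
Qed.

Lemma EFin_Rintegral_bounded f b : measurable_fun setT f ->
  (forall x, `|f x| <= b) ->
  ((\int[P]_x f x)%:E = \int[P]_x (f x)%:E)%E.
Proof.
move=> mf fb; rewrite /Rintegral fineK//.
by apply: integrable_fin_num => //; exact: integrable_bounded mf fb.
Qed.

Lemma norm_Rintegral_bounded f b : measurable_fun setT f ->
  (forall x, `|f x| <= b) -> `|\int[P]_x f x| <= b.
Proof.
move=> mf fb.
have If := integrable_bounded mf fb.
rewrite (le_trans (le_normr_Rintegral _ If))// -[leRHS]Rintegral_cst_probability.
apply: le_Rintegral => //.
- apply: (@integrable_bounded _ b) => [|x]; last by rewrite normr_id.
  exact: measurableT_comp.
- exact: finite_measure_integrable_cst.
Qed.

Lemma mgf_bounded f b t : measurable_fun setT f ->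
  (forall x, `|f x| <= b) ->
  (\int[P]_x (expR (t * (\int[P]_z f z - f x)))%:E <=
    (expR (8 * (t * b) ^+ 2))%:E)%E.
Proof.
move=> mf fb; set m := \int[P]_z f z; set K := expR _.
have mb : `|m| <= b by exact: norm_Rintegral_bounded.
have If := integrable_bounded mf fb.
(* The pointwise majorant given by [expR_le_add_expR_sqr]; its centred part integrates to 0, so its
   integral is [K]. The 8 in [K] is [2 * 2 ^+ 2], from [|m - f x| <= 2 * b]. *)
pose g x := t * m + K - t * f x.
have mg : measurable_fun setT g.
  apply: measurable_funB; first exact: measurable_cst.
  by apply: measurable_funM => //; exact: measurable_cst.
have Ig : (\int[P]_x (g x)%:E = K%:E)%E.
  rewrite -(@EFin_Rintegral_bounded g (`|t| * b + K + `|t| * b))//; last first.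
    move=> x; rewrite /g (le_trans (ler_normB _ _))// lerD//.
      rewrite (le_trans (ler_normD _ _))// lerD// ?normrM ?ler_wpM2l//.
      by rewrite ger0_norm// expR_ge0.
    by rewrite normrM ler_wpM2l.
  congr EFin; rewrite /g RintegralB//.
  - rewrite RintegralZl// Rintegral_cst_probability -/m.
    by rewrite addrAC subrr add0r.
  - exact: finite_measure_integrable_cst.
  - have -> : EFin \o (fun x => t * f x) = (fun x => t%:E * (f x)%:E)%E.
      by apply/funext.
    exact: integrableZl.
rewrite -Ig; apply: ge0_le_integral => //.
- apply/measurable_EFinP; apply: measurableT_comp => //.
  apply: measurable_funM; first exact: measurable_cst.
  by apply: measurable_funB => //; exact: measurable_cst.
- exact/measurable_EFinP.
move=> x _; rewrite lee_fin /g.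
set z := t * (m - f x).
have -> : t * m + K - t * f x = z + K by rewrite /z; ring.
rewrite (le_trans (expR_le_add_expR_sqr z))// lerD2l ler_expR.
have : `|m - f x| <= 2 * b.
  by rewrite (le_trans (ler_normB _ _))// mulr2n mulrDl !mul1r lerD.
move=> h; rewrite /z !exprMn -(real_normK (num_real (m - f x))).
have -> : 8 * (t ^+ 2 * b ^+ 2) = 2 * (t ^+ 2 * (2 * b) ^+ 2) by ring.
by rewrite !ler_wpM2l ?sqr_ge0// lerXn2r// nnegrE// (le_trans _ h).
Qed.

End bounded_expectation.

(** The sign is kept: the gap is positive where the sample underestimates the mean, the case in
    which the robust risk has to compensate. *)
Definition empirical_gap {R : realType} {d d' : measure_display}
    {W : measurableType d} {U : measurableType d'} (P : probability U R)
    (n : nat) (X : 'I_n -> W -> U) (f : U -> R) (w : W) : R :=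
  \int[P]_x f x - n%:R^-1 * \sum_(i < n) f (X i w).

(** * Hoeffding's inequality *)

Section hoeffding.
Context {R : realType} {d d' : measure_display} {W : measurableType d}
  {U : measurableType d'} (Pr : probability W R) (P : probability U R)
  (n : nat) (X : 'I_n -> {RV Pr >-> U}).
Hypothesis lawX : forall i (A : set U), measurable A ->
  distribution Pr (X i) A = P A.
Hypothesis indepX : forall A : 'I_n -> set U, (forall i, measurable (A i)) ->
  Pr (\bigcap_i (X i @^-1` A i)) = (\prod_(i < n) Pr (X i @^-1` A i))%E.
Implicit Types (f : U -> R) (b s : R).

Lemma measurable_empirical_gap f : measurable_fun setT f ->
  measurable_fun setT (empirical_gap P X f).
Proof.
move=> mf; apply: measurable_funB; first exact: measurable_cst.
apply: measurable_funM; first exact: measurable_cst.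
by apply: measurable_sum => i; exact: measurableT_comp.
Qed.

(** Chernoff's method: Markov's inequality for the exponential of the gap, factorisation by
    independence, then [mgf_bounded] for each factor. The constant 6 makes the final exponent
    [2 * s ^+ 2 - 3 * s ^+ 2]. *)
Lemma hoeffding f b s : (0 < n)%N -> measurable_fun setT f -> 0 < b ->
  (forall x, `|f x| <= b) -> 0 <= s ->
  (Pr [set w | 6 * b * s / Num.sqrt n%:R <= empirical_gap P X f w]%R <=
    (expR (- s ^+ 2))%:E)%E.
Proof.
move=> n0 mf b0 fb s0; set r := Num.sqrt _.
set a := 6 * b * s / _; set A := [set w | _].
have mgap := measurable_empirical_gap mf.
have mA : measurable A.
  have -> : A = empirical_gap P X f @^-1` `[a, +oo[.
    by rewrite preimage_itvcy.
  by rewrite -[X in measurable X]setTI; exact: mgap.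
have rn0 : 0 < r by rewrite sqrtr_gt0 ltr0n.
have rn2 : r ^+ 2 = n%:R by rewrite sqr_sqrtr.
set m := \int[P]_x f x.
(* For this [t], [8 n (t b)^2 - n t a = - s^2]. *)
pose t := s / (2 * r * b).
have t0 : 0 <= t by rewrite divr_ge0// !mulr_ge0// ltW.
pose u (i : 'I_n) x := expR (t * (m - f x)).
have mu i : measurable_fun setT (u i).
  apply: measurableT_comp => //; apply: measurable_funM.
    exact: measurable_cst.
  by apply: measurable_funB => //; exact: measurable_cst.
have uE i : (\int[Pr]_w (u i (X i w))%:E = \int[P]_x (expR (t * (m - f x)))%:E)%E.
  transitivity (\int[distribution Pr (X i)]_x (expR (t * (m - f x)))%:E)%E;
    last by apply: eq_measure_integral => B mB _; exact: lawX.
  rewrite ge0_integral_distribution//.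
  by apply/measurable_EFinP; exact: (mu i).
have mgf := mgf_bounded P t mf fb; rewrite -/m in mgf.
have mgf0 : (0 <= \int[P]_x (expR (t * (m - f x)))%:E)%E.
  by apply: integral_ge0 => x _; rewrite lee_fin expR_ge0.
have mgf_fin : (\int[P]_x (expR (t * (m - f x)))%:E)%E \is a fin_num.
  by rewrite ge0_fin_numE// (le_lt_trans mgf)// ltry.
have gapE w : n%:R * t * empirical_gap P X f w = \sum_(i < n) t * (m - f (X i w)).
  rewrite -mulr_sumr sumrB sumr_const card_ord -[m *+ n]mulr_natl.
  rewrite /empirical_gap -/m; field.
  by rewrite pnatr_eq0 -lt0n.
have step1 : (\int[Pr]_w (\prod_(i < n) u i (X i w))%:E <=
    (expR (8 * (t * b) ^+ 2) ^+ n)%:E)%E.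
  rewrite (ge0_integral_prod_indep indepX)//; last 2 first.
  - by move=> i x; exact: expR_ge0.
  - by move=> i; rewrite uE.
  under eq_bigr do rewrite uE.
  rewrite -(fineK mgf_fin) prodEFin prodr_const card_ord lee_fin.
  apply: lerXn2r; rewrite ?nnegrE ?expR_ge0 ?fine_ge0//.
  by rewrite -lee_fin fineK.
(* Markov's inequality: on [A] the product is at least [expR (n%:R * t * a)]. *)
have step2 : ((expR (n%:R * t * a))%:E * Pr A <=
    \int[Pr]_w (\prod_(i < n) u i (X i w))%:E)%E.
  rewrite -[A]setIT -integral_indic// -ge0_integralZl_EFin ?expR_ge0//; last first.
    exact/measurable_EFinP/measurable_indic.
  apply: ge0_le_integral => //.
  - apply: measurable_funeM; exact/measurable_EFinP/measurable_indic.
  - apply/measurable_EFinP; apply: measurable_prod => i _.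
    exact: measurableT_comp (mu i) _.
  move=> w _; rewrite -EFinM lee_fin /u -expR_sum -gapE indicE.
  have [/set_mem wA|_] := boolP (w \in A); last by rewrite mulr0// expR_ge0.
  by rewrite mulr1 ler_expR ler_wpM2l// mulr_ge0.
have step3 := le_trans step2 step1.
rewrite muleC -lee_pdivlMr ?expR_gt0// in step3.
apply: (le_trans step3); rewrite -EFinM lee_fin -expRN -expRM_natl -expRD.
rewrite ler_expR -rn2 le_eqVlt; apply/orP; left; apply/eqP.
by rewrite /t /a; field; rewrite !gt_eqF.
Qed.

End hoeffding.

(** * Chaining *)

Section empirical_gap_theory.
Context {R : realType} {d d' : measure_display} {W : measurableType d}
  {U : measurableType d'} (P : probability U R) (n : nat) (X : 'I_n -> W -> U).
Implicit Types (f g : U -> R) (b : R).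

Lemma empirical_gapB f g b c w : measurable_fun setT f ->
  measurable_fun setT g -> (forall x, `|f x| <= b) -> (forall x, `|g x| <= c) ->
  empirical_gap P X (f \- g) w = empirical_gap P X f w - empirical_gap P X g w.
Proof.
move=> mf mg fb gc; rewrite /empirical_gap RintegralB//.
- by rewrite sumrB mulrBr; ring.
- exact: integrable_bounded mf fb.
- exact: integrable_bounded mg gc.
Qed.

Lemma empirical_gap_le f b w : (0 < n)%N -> measurable_fun setT f ->
  (forall x, `|f x| <= b) -> empirical_gap P X f w <= 2 * b.
Proof.
move=> n0 mf fb; rewrite /empirical_gap mulr2n mulrDl !mul1r.
apply: (@le_trans _ _ (`|\int[P]_x f x| + n%:R^-1 * \sum_(i < n) `|f (X i w)|)).
  apply: lerD; first exact: ler_norm.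
  rewrite -mulrN ler_wpM2l ?invr_ge0// -sumrN; apply: ler_sum => i _.
  by rewrite -normrN ler_norm.
apply: lerD; first exact: norm_Rintegral_bounded.
rewrite mulrC ler_pdivrMr ?ltr0n//.
rewrite (le_trans (ler_sum _ (fun i _ => fb (X i w))))//.
by rewrite sumr_const card_ord mulr_natr.
Qed.

End empirical_gap_theory.

Lemma sum_half_pow_le (R : realFieldType) (m : nat) :
  \sum_(k < m) (2 ^+ k)^-1 <= 2 :> R.
Proof.
suff -> : \sum_(k < m) (2 ^+ k)^-1 = 2 - 2 * (2 ^+ m)^-1 :> R.
  by rewrite gerBl mulr_ge0// invr_ge0 exprn_ge0.
elim: m => [|m IH]; first by rewrite big_ord0 expr0 invr1 mulr1 subrr.
rewrite big_ord_recr/= IH exprS; field.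
by rewrite expf_neq0.
Qed.

Lemma sum_succ_half_pow_le (R : realFieldType) (m : nat) :
  \sum_(k < m) (2 ^+ k)^-1 * k.+1%:R <= 4 :> R.
Proof.
suff -> : \sum_(k < m) (2 ^+ k)^-1 * k.+1%:R =
    4 - (2 * m%:R + 4) * (2 ^+ m)^-1 :> R.
  by rewrite gerBl mulr_ge0// ?invr_ge0 ?exprn_ge0// addr_ge0// mulr_ge0.
elim: m => [|m IH].
  by rewrite big_ord0 expr0 invr1; ring.
rewrite big_ord_recr/= IH exprS -natr1; field.
by rewrite expf_neq0.
Qed.

Section chaining.
Context {R : realType} {d d' : measure_display} {W : measurableType d}
  {U : measurableType d'} (Pr : probability W R) (P : probability U R)
  (n : nat) (X : 'I_n -> {RV Pr >-> U}).
Hypothesis n_gt0 : (0 < n)%N.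
Hypothesis lawX : forall i (A : set U), measurable A ->
  distribution Pr (X i) A = P A.
Hypothesis indepX : forall A : 'I_n -> set U, (forall i, measurable (A i)) ->
  Pr (\bigcap_i (X i @^-1` A i)) = (\prod_(i < n) Pr (X i @^-1` A i))%E.

Variables (F : set (U -> R)) (M A : R) (N : nat -> nat)
  (net : nat -> nat -> U -> R).
Hypothesis M_gt0 : 0 < M.
Hypothesis mF : forall f, F f -> measurable_fun setT f.
Hypothesis mnet : forall k j, (j < N k)%N -> measurable_fun setT (net k j).
Hypothesis N_gt0 : forall k, (0 < N k)%N.
Hypothesis net0 : forall j, net 0 j = cst 0.
Hypothesis net_cover : forall f k, F f ->
  exists2 j, (j < N k)%N & forall x, `|f x - net k j x| <= M / 2 ^+ k.
Hypothesis net_entropy : forall m,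
  \sum_(k < m) M / 2 ^+ k * Num.sqrt (ln (N k)%:R) <= A.

Variable delta : R.
Hypothesis delta01 : 0 < delta < 1.

Let a k : R := M / 2 ^+ k.
Let v k : R := Num.sqrt (ln (N k)%:R).
Let L : R := Num.sqrt (ln (2 / delta)).
Let s k : R := v k + v k.+1 + k.+1%:R + L.

Let a_gt0 k : 0 < a k. Proof. by rewrite divr_gt0// exprn_gt0. Qed.
Let v_ge0 k : 0 <= v k. Proof. exact: sqrtr_ge0. Qed.
Let L_ge0 : 0 <= L. Proof. exact: sqrtr_ge0. Qed.
Let s_ge0 k : 0 <= s k.
Proof. by rewrite !addr_ge0. Qed.

(* By the choice of [s], a union bound over the [N k * N k.+1] possible links
   between two consecutive nets costs at most [delta / 2 ^ k.+1]. *)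
Let bad1 k j i : set W :=
  if `[< forall x, `|net k.+1 j x - net k i x| <= 2 * a k >] then
    [set w | 6 * (2 * a k) * s k / Num.sqrt n%:R <=
             empirical_gap P X (net k.+1 j \- net k i) w]
  else set0.

Let bad k : set W :=
  \big[setU/set0]_(j < N k.+1) \big[setU/set0]_(i < N k) bad1 k j i.

Let measurable_bad1 k j i : (j < N k.+1)%N -> (i < N k)%N ->
  measurable (bad1 k j i).
Proof.
move=> jN iN; rewrite /bad1; case: ifPn => // _.
set e := 6 * (2 * a k) * s k / Num.sqrt n%:R.
rewrite (_ : [set w | _] =
  empirical_gap P X (net k.+1 j \- net k i) @^-1` `[e, +oo[); last first.
  by rewrite preimage_itvcy.
rewrite -[X in measurable X]setTI.
apply: measurable_empirical_gap => //.
by apply: measurable_funB; exact: mnet.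
Qed.

Let measurable_bad k : measurable (bad k).
Proof.
apply: bigsetU_measurable => j _; apply: bigsetU_measurable => i _.
exact: measurable_bad1.
Qed.

(** The square of a sum of nonnegative terms dominates the sum of their squares. In the exponential,
    the two logarithms cancel the number of links, [k.+1] yields the geometric factor since
    [2 <= expR 1], and [L ^+ 2] yields [delta / 2]. *)
Let expR_s k : (N k.+1)%:R * (N k)%:R * expR (- s k ^+ 2) <= delta / 2 ^+ k.+1.
Proof.
case/andP: delta01 => d0 d1.
have N1 l : 1 <= (N l)%:R :> R by rewrite ler1n.
have Npos l : 0 < (N l)%:R :> R by rewrite ltr0n.
have vE l : v l ^+ 2 = ln (N l)%:R by rewrite sqr_sqrtr// ln_ge0.
have LE : L ^+ 2 = ln (2 / delta).
  by rewrite sqr_sqrtr// ln_ge0// ler_pdivlMr//; lra.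
have k1 : (1 : R) <= k.+1%:R by rewrite ler1n.
have sE : ln (N k)%:R + ln (N k.+1)%:R + k.+1%:R + ln (2 / delta) <= s k ^+ 2.
  rewrite -!vE -LE /s.
  have := v_ge0 k; have := v_ge0 k.+1; have := L_ge0.
  move: (v k) (v k.+1) L k.+1%:R k1 => x y l z z1 l0 y0 x0.
  have : 0 <= x * y by rewrite mulr_ge0.
  have : 0 <= x * z by rewrite mulr_ge0//; lra.
  have : 0 <= x * l by rewrite mulr_ge0.
  have : 0 <= y * z by rewrite mulr_ge0//; lra.
  have : 0 <= y * l by rewrite mulr_ge0.
  have : 0 <= z * l by rewrite mulr_ge0//; lra.
  have : z <= z ^+ 2 by rewrite expr2 ler_peMl//; lra.
  nra.
apply: (@le_trans _ _ ((N k.+1)%:R * (N k)%:R * expR (-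
    (ln (N k)%:R + ln (N k.+1)%:R + k.+1%:R + ln (2 / delta))))).
  by rewrite ler_wpM2l ?mulr_ge0// ler_expR lerN2.
rewrite expRN !expRD !lnK ?posrE//; last by rewrite divr_gt0.
have e2 : 2 ^+ k.+1 <= expR k.+1%:R :> R.
  rewrite -[k.+1%:R]mulr1 expRM_natl lerXn2r// ?nnegrE ?expR_ge0//.
  by rewrite (le_trans _ (expR_ge1Dx _)).
have p2 : 0 < 2 ^+ k.+1 :> R by rewrite exprn_gt0.
have -> : (N k.+1)%:R * (N k)%:R *
  ((N k)%:R * (N k.+1)%:R * expR k.+1%:R * (2 / delta))^-1 =
  delta / 2 * (expR k.+1%:R)^-1 :> R.
  by field; rewrite !gt_eqF ?expR_gt0.
rewrite ler_pM//; first by rewrite divr_ge0// ltW.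
  by rewrite ler_pdivrMr//; lra.
by rewrite lef_pV2// posrE expR_gt0.
Qed.

Let Pr_bad k : (Pr (bad k) <= (delta / (2 ^ k.+1)%:R)%:E)%E.
Proof.
have b1 j i : (j < N k.+1)%N -> (i < N k)%N ->
    (Pr (bad1 k j i) <= (expR (- s k ^+ 2))%:E)%E.
  move=> jN iN; rewrite /bad1; case: ifPn => [/asboolP gap|_]; last first.
    by rewrite measure0 lee_fin expR_ge0.
  apply: hoeffding => //; last by rewrite mulr_gt0.
  by apply: measurable_funB; exact: mnet.
rewrite natrX; apply: le_trans (_ : _ <= ((N k.+1)%:R * (N k)%:R *
    expR (- s k ^+ 2))%:E)%E _; last by rewrite lee_fin expR_s.
have b2 j : (j < N k.+1)%N -> (Pr (\big[setU/set0]_(i < N k) bad1 k j i) <=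
    ((N k)%:R * expR (- s k ^+ 2))%:E)%E.
  move=> jN; apply: le_trans.
    by apply: Boole_inequality => i iN; exact: measurable_bad1.
  apply: le_trans.
    by apply: lee_sum => i _; apply: b1 => //; exact: ltn_ord.
  by rewrite sumEFin sumr_const card_ord mulr_natl.
apply: le_trans.
  apply: (Boole_inequality Pr
    (A := fun j => \big[setU/set0]_(i < N k) bad1 k j i)) => j jN.
  by apply: bigsetU_measurable => i _; exact: measurable_bad1.
apply: le_trans.
  by apply: lee_sum => j _; apply: b2; exact: ltn_ord.
by rewrite sumEFin sumr_const card_ord -mulrA (mulr_natl _ (N k.+1)).
Qed.

(** Term by term in [s k]: the [v k] contribute [A], the [v k.+1] contribute [2 * A] because
    [a k = 2 * a k.+1], the [k.+1] contribute [4 * M] and the constant [L] contributes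
    [2 * M * L]. *)
Let sum_bound m : \sum_(k < m) 6 * (2 * a k) * s k <=
  12 * (3 * A + 4 * M) + 24 * M * L.
Proof.
have -> : \sum_(k < m) 6 * (2 * a k) * s k = 12 * (\sum_(k < m) a k * v k +
    2 * (\sum_(k < m) a k.+1 * v k.+1) +
    M * \sum_(k < m) (2 ^+ k)^-1 * k.+1%:R + M * L * \sum_(k < m) (2 ^+ k)^-1).
  rewrite !mulr_sumr -!big_split/= mulr_sumr; apply: eq_bigr => k _.
  rewrite /s /a exprS; field.
  by rewrite expf_neq0.
have h1 : \sum_(k < m) a k * v k <= A by exact: net_entropy.
have h2 : \sum_(k < m) a k.+1 * v k.+1 <= A.
  apply: le_trans (net_entropy m.+1); rewrite big_ord_recl/= lerDr.
  by rewrite mulr_ge0//; apply: ltW; exact: a_gt0.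
have h3 := sum_succ_half_pow_le R m.
have h4 := sum_half_pow_le R m.
have h5 : M * \sum_(k < m) (2 ^+ k)^-1 * k.+1%:R <= M * 4.
  by rewrite ler_wpM2l// ltW.
have h6 : M * L * \sum_(k < m) (2 ^+ k)^-1 <= M * L * 2.
  by rewrite ler_wpM2l// mulr_ge0// ltW.
lra.
Qed.

Lemma chaining : exists E : set W, [/\ measurable E,
  ((1 - delta)%:E <= Pr E)%E &
  forall w f, E w -> F f -> empirical_gap P X f w <=
    (12 * (3 * A + 4 * M) + 24 * M * L) / Num.sqrt n%:R].
Proof.
have mB : measurable (\bigcup_k bad k) by exact: bigcup_measurable.
case/andP: delta01 => d0 d1.
exists (~` \bigcup_k bad k); split; first exact: measurableC.
  rewrite probability_setC// EFinB leeB//.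
  apply: le_trans (epsilon_trick0 xpredT (ltW d0)).
  apply: le_trans (_ : _ <= \sum_(k <oo) Pr (bad k))%E _.
    exact: measure_sigma_subadditive.
  by apply: lee_nneseries => // k *; exact: Pr_bad.
move=> w f nbad Ff.
have mf := mF Ff.
have [j jP] : {j : nat -> nat & forall k, (j k < N k)%N /\
    forall x, `|f x - net k (j k) x| <= a k}.
  apply: (@choice _ _ (fun k j => (j < N k)%N /\
    forall x, `|f x - net k j x| <= a k)) => k.
  by have [j jN jf] := net_cover k Ff; exists j.
pose h k := net k (j k).
have mh k : measurable_fun setT (h k) by apply: mnet; case: (jP k).
have fh k x : `|f x - h k x| <= a k by case: (jP k) => _; exact.
have a0 : a 0 = M by rewrite /a expr0 divr1.
have h0 : h 0 = cst 0 by exact: net0.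
have fM x : `|f x| <= M.
  by have := fh 0 x; rewrite h0 /= subr0 a0.
have hM k x : `|h k x| <= M + a k.
  have -> : h k x = f x - (f x - h k x) by ring.
  by rewrite (le_trans (ler_normB _ _))// lerD.
(* Both [h k] and [h k.+1] are close to [f], so the link has length at most
   [a k + a k.+1 <= 2 * a k] and is among those controlled outside [bad k]. *)
have step k : empirical_gap P X (h k.+1 \- h k) w <=
    6 * (2 * a k) * s k / Num.sqrt n%:R.
  rewrite leNgt; apply/negP => /ltW gap; apply: nbad; exists k => //.
  rewrite /bad -(bigcup_mkord _
    (fun j => \big[setU/set0]_(i < N k) bad1 k j i)).
  exists (j k.+1); first by case: (jP k.+1).
  rewrite -(bigcup_mkord _ (bad1 k (j k.+1))); exists (j k); first by case: (jP k).
  rewrite /bad1; case: ifPn => // /asboolP[] x.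
  have -> : net k.+1 (j k.+1) x - net k (j k) x =
    (f x - h k x) - (f x - h k.+1 x) by rewrite /h; ring.
  rewrite (le_trans (ler_normB _ _))// mulr2n mulrDl !mul1r lerD//.
  rewrite (le_trans (fh _ _))// /a ler_pM2l// lef_pV2 ?posrE ?exprn_gt0//.
  by rewrite ler_weXn2l// ler1n.
(* The chain starts at [h 0 = cst 0], whose gap is 0, so the increments telescope. *)
have tele m : empirical_gap P X (h m) w <=
    (\sum_(k < m) 6 * (2 * a k) * s k) / Num.sqrt n%:R.
  elim: m => [|m IH].
    rewrite big_ord0 mul0r h0 /empirical_gap Rintegral_cst_probability.
    by rewrite big1// mulr0 subr0.
  rewrite big_ord_recr/= mulrDl (le_trans _ (lerD IH (step m)))//.
  by rewrite (empirical_gapB _ _ _ (mh m.+1) (mh m) (hM _) (hM _)) addrC subrK.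
have bound m : empirical_gap P X f w <=
    (12 * (3 * A + 4 * M) + 24 * M * L) / Num.sqrt n%:R + 2 * a m.
  have gapfh : empirical_gap P X (f \- h m) w <= 2 * a m.
    apply: empirical_gap_le => //; last exact: fh.
    by apply: measurable_funB => //; exact: mh.
  rewrite (empirical_gapB _ _ _ mf (mh m) fM (hM _)) lerBlDl in gapfh.
  apply: (le_trans gapfh); rewrite lerD2r (le_trans (tele m))//.
  by rewrite ler_wpM2r ?invr_ge0 ?sqrtr_ge0.
apply/ler_addgt0Pr => e e0.
(* Then [2 * M / e <= m <= 2 ^ m], so the remainder [2 * a m] is at most [e]. *)
pose m := (Num.truncn (2 * M / e)).+1.
apply: (le_trans (bound m)); rewrite lerD2l /a.
rewrite mulrA ler_pdivrMr ?exprn_gt0// [e * _]mulrC -ler_pdivrMr//.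
apply: (le_trans (ltW (truncnS_gt _))).
by rewrite -natrX ler_nat ltnW// ltn_expl.
Qed.

End chaining.

(** * Packing numbers and the entropy integral *)

(** The upper level sets of [f] within [D] are intervals. *)
Lemma nonincreasing_emeasurable (R : realType) (D : set R) (f : R -> \bar R) :
  is_interval D ->
  (forall x y, D x -> D y -> x <= y -> (f y <= f x)%E) ->
  measurable_fun D f.
Proof.
move=> iD f_dec; apply: (measurability _ (ErealGenCInfty.measurableE R)).
move=> _ [_ [r ->] <-]; apply: is_interval_measurable => x y.
rewrite /= !in_itv/= !andbT => -[Dx fx] [Dy fy] z xzy.
have Dz := iD _ _ Dx Dy _ xzy.
split => //; rewrite !in_itv/= !andbT.
by apply: le_trans fy _; apply: f_dec => //; case/andP: xzy.
Qed.

(** On the interval from [t / 2 ^+ k.+1] to [t / 2 ^+ k], of length [t / 2 ^+ k / 2], [f] is at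
    least its value at the right endpoint; these intervals are disjoint. *)
Lemma dyadic_sum_le_integral (R : realType) (f : R -> \bar R) (t : R) (m : nat) :
  0 < t -> (forall x, (0%R <= f x)%E) ->
  (forall x y, 0 < x -> x <= y -> (f y <= f x)%E) ->
  (\sum_(k < m) (t / 2 ^+ k / 2)%:E * f (t / 2 ^+ k)%R <=
    \int[lebesgue_measure]_(x in `]0%R, +oo[) f x)%E.
Proof.
move=> t0 f0 f_dec.
have p k : 0 < t / 2 ^+ k by rewrite divr_gt0// exprn_gt0.
have pS k : t / 2 ^+ k.+1 = t / 2 ^+ k / 2.
  by rewrite exprS; field; rewrite expf_neq0.
have mf : measurable_fun (`]0%R, +oo[%classic : set R) f.
  apply: nonincreasing_emeasurable; first exact: interval_is_interval.
  by move=> x y; rewrite /= in_itv/= andbT => x0 _; exact: f_dec.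
have sub a b : 0 <= a ->
    (`]a, b]%classic : set R) `<=` (`]0%R, +oo[%classic : set R).
  move=> a0 x; rewrite /= !in_itv/= andbT => /andP[ax _].
  exact: le_lt_trans ax.
have mfs a b : 0 <= a -> measurable_fun (`]a, b]%classic : set R) f.
  by move=> a0; apply: measurable_funS mf => //; exact: sub.
suff H : (\sum_(k < m) (t / 2 ^+ k / 2)%:E * f (t / 2 ^+ k)%R <=
    \int[lebesgue_measure]_(x in `](t / 2 ^+ m)%R, t]) f x)%E.
  apply: (le_trans H); apply: ge0_subset_integral => //.
  by apply: sub; rewrite ltW.
elim: m => [|m IH]; first by rewrite big_ord0; exact: integral_ge0.
have le1 : t / 2 ^+ m.+1 <= t / 2 ^+ m by rewrite pS; have := p m; lra.
have le2 : t / 2 ^+ m <= t.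
  rewrite ler_pdivrMr ?exprn_gt0// ler_peMr// ?exprn_ege1 ?ler1n//.
  exact: ltW.
rewrite (@itv_bndbnd_setU _ _ _ (BRight (t / 2 ^+ m))) ?bnd_simp//.
rewrite setUC ge0_integral_setU//=; last 2 first.
- rewrite setUC -itv_bndbnd_setU ?bnd_simp//.
  by apply: mfs; rewrite ltW.
- rewrite disj_set2E; apply/eqP/seteqP; split => // x [].
  by rewrite /= !in_itv/= => /andP[+ _] /andP[_]; rewrite ltNge => /negP.
rewrite big_ord_recr/=; apply: leeD => //.
apply: (@le_trans _ _ (\int[lebesgue_measure]_(x in
    `](t / 2 ^+ m.+1)%R, (t / 2 ^+ m)%R]) f (t / 2 ^+ m)%R)%E); last first.
  apply: ge0_le_integral => //; first by apply: mfs; rewrite ltW.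
  move=> x; rewrite /= in_itv/= => /andP[tx xt]; apply: f_dec => //.
  exact: lt_trans tx.
have mu_itv : lebesgue_measure
    (`](t / 2 ^+ m.+1)%R, (t / 2 ^+ m)%R]%classic : set R) =
    (t / 2 ^+ m / 2)%:E.
  rewrite lebesgue_measure_itv/= lte_fin.
  have -> : t / 2 ^+ m.+1 < t / 2 ^+ m by rewrite pS; have := p m; lra.
  by rewrite -EFinB pS; congr EFin; field; rewrite expf_neq0.
by rewrite integral_cst// [X in (_ <= _ * X)%E]mu_itv muleC.
Qed.

Section supnorm.
Context {T : pointedType} {R : realType}.
Implicit Types (f : T -> R) (b : R).

(** The bound on [f] matters: [sup] of an unbounded set is the default value 0. *)
Lemma ler_supnorm f b x : (forall y, `|f y| <= b) -> `|f x| <= supnorm f.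
Proof.
move=> fb; apply: ub_le_sup; last by exists x.
by exists b => _ [y _ <-].
Qed.

Lemma supnorm_le f b : (forall y, `|f y| <= b) -> supnorm f <= b.
Proof.
move=> fb; apply: ge_sup; first by exists `|f point|, point.
by move=> _ [y _ <-].
Qed.

Lemma supnorm_distC f g : supnorm (f \- g) = supnorm (g \- f).
Proof.
congr sup; apply/seteqP; split => _ [x _ <-]; exists x => //; exact: distrC.
Qed.

End supnorm.

Section packing.
Context {T : pointedType} {R : realType} (F : set (T -> R)).

Let packing (t : R) (n : nat) := exists S : set (T -> R), [/\ S `<=` F,
  (S #= `I_n)%card & forall f g, S f -> S g -> f <> g -> t <= supnorm (f \- g)].

Lemma packing_number_le (s t : R) : s <= t ->
  (packing_number F t <= packing_number F s)%E.
Proof.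
move=> st; apply: le_ereal_sup => _ [n [S [SF Sn Sep]] <-]; exists n => //.
by exists S; split => // f g Sf Sg fg; rewrite (le_trans st)// Sep.
Qed.

Lemma packing_number_ge1 (t : R) : F !=set0 -> (1 <= packing_number F t)%E.
Proof.
move=> [f Ff]; apply: ereal_sup_ubound; exists 1%N => //.
exists [set f]; split; first by move=> _ ->.
  exact: card_set1.
by move=> _ _ -> ->.
Qed.

(* A packing that cannot be enlarged is a net. *)
Lemma packing_number_net (t M : R) : 0 < t -> (forall f x, F f -> `|f x| <= M) ->
  (packing_number F t < +oo)%E ->
  exists n (g : nat -> T -> R), [/\ (n%:R%:E <= packing_number F t)%E,
    forall j, (j < n)%N -> F (g j) &
    forall f, F f -> exists2 j, (j < n)%N & forall x, `|f x - g j x| <= t].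
Proof.
move=> t0 FM fin.
(* Otherwise, starting from the empty packing, there would be packings of every size and the packing
   number would be infinite. *)
have [n [pn nSn]] : exists n, packing t n /\ ~ packing t n.+1.
  apply: contrapT => /forallNP h.
  have all_p n : packing t n.
    elim: n => [|n pn]; first by exists set0; split => //; rewrite II0.
    by apply: contrapT => nSn; apply: (h n).
  have : (packing_number F t = +oo)%E.
    apply/eq_infty => r; apply: (@le_trans _ _ ((Num.truncn r).+1%:R%:E : \bar R)%E).
      by rewrite lee_fin ltW// truncnS_gt.
    by apply: ereal_sup_ubound; exists (Num.truncn r).+1 => //; exact: all_p.
  by move=> e; rewrite e in fin.
have np : (n%:R%:E <= packing_number F t)%E.
  by apply: ereal_sup_ubound; exists n.
case: pn => S [SF Sn Sep].
have /pcard_eqP/bijPex[/= g g_bij] : (`I_n #= S)%card by rewrite card_eq_sym.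
exists n, g; split => //.
  by move=> j jn; apply: SF; apply: (set_bij_sub g_bij); exists j.
move=> f Ff; apply: contrapT => nf.
(* An [f] covered by no point of [S] is [t]-separated from [S], so adding it gives a packing of size
   [n.+1]. *)
have sepf h : S h -> t <= supnorm (f \- h).
  move=> Sh; rewrite leNgt; apply/negP => lt_t; apply: nf.
  have [j jn gj] := set_bij_surj g_bij Sh; exists j => // x.
  rewrite gj; apply: le_trans (ltW lt_t).
  apply: (@ler_supnorm _ _ (f \- h) (M + M)) => y.
  by rewrite (le_trans (ler_normB _ _))// lerD// FM//; exact: SF.
have nSf : ~ S f.
  move=> /sepf; rewrite leNgt => /negP; apply; apply: le_lt_trans t0.
  by apply: supnorm_le => y /=; rewrite subrr normr0.
apply: nSn; exists (f |` S); split.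
- by move=> h [->//|]; exact: SF.
- apply/eq_cardSP; exists f; first by left.
  have -> : (f |` S) `\ f = S.
    apply/seteqP; split => [h [[hf|//] hnf]|h Sh].
      by exfalso; exact: hnf.
    split; first by right.
    by move=> hf; rewrite hf in Sh; exact: nSf.
  exact: Sn.
move=> f1 f2 [->|Sf1] [->|Sf2] //; first by move=> _; exact: sepf.
  by move=> _; rewrite supnorm_distC; exact: sepf.
exact: Sep.
Qed.

(** Maximal packings supply the nets at scales [M / 2 ^+ k]. Each term of the entropy sum is twice
    the matching term of [dyadic_sum_le_integral] or less, hence the factor 2. *)
Lemma dyadic_nets (M : R) : 0 < M -> F !=set0 ->
  (forall f x, F f -> `|f x| <= M) -> (dudley_entropy F < +oo)%E ->
  exists (N : nat -> nat) (net : nat -> nat -> T -> R),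
  [/\ forall k, (0 < N k)%N, forall j, net 0 j = cst 0,
    forall k j, (j < N k)%N -> net k j = cst 0 \/ F (net k j),
    forall f k, F f -> exists2 j, (j < N k)%N &
      forall x, `|f x - net k j x| <= M / 2 ^+ k &
    forall m, \sum_(k < m) M / 2 ^+ k * Num.sqrt (ln (N k)%:R) <=
      2 * fine (dudley_entropy F)].
Proof.
move=> M0 F0 FM ent.
pose e t := ((lne (packing_number F t)) `^ 2^-1)%E.
have e0 t : (0%R <= e t)%E by exact: poweR_ge0.
have pos1 (n : \bar R) : (1 <= n)%E -> n \in `[0%E, +oo%E].
  by move=> n1; rewrite in_itv/= leey andbT (le_trans _ n1).
have lnpos (n : \bar R) : (1 <= n)%E -> lne n \in `[0%E, +oo%E].
  by move=> n1; rewrite in_itv/= leey andbT -lne1 lee_lne// pos1.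
have e_le (n1 n2 : \bar R) : (1 <= n1)%E -> (n1 <= n2)%E ->
    (lne n1 `^ 2^-1 <= lne n2 `^ 2^-1)%E.
  move=> n11 n12; have n21 := le_trans n11 n12.
  by apply: gt0_ler_poweR; rewrite ?lnpos// lee_lne ?pos1.
have e_dec s t : s <= t -> (e t <= e s)%E.
  by move=> st; apply: e_le; [exact: packing_number_ge1|exact: packing_number_le].
have dyad t m : 0 < t ->
    (\sum_(k < m) (t / 2 ^+ k / 2)%:E * e (t / 2 ^+ k)%R <= dudley_entropy F)%E.
  by move=> t0; apply: dyadic_sum_le_integral => // x y _; exact: e_dec.
have p k : 0 < M / 2 ^+ k by rewrite divr_gt0// exprn_gt0.
(* An infinite packing number at one scale makes a one-term dyadic sum infinite, hence also the
   entropy. *)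
have fin k : (packing_number F (M / 2 ^+ k)%R < +oo)%E.
  rewrite ltey; apply/eqP => Py; have := dyad _ 1%N (p k).
  rewrite big_ord1 expr0 divr1 /e Py [lne _]/= poweRyr//.
  rewrite gt0_muley ?lte_fin ?divr_gt0// leye_eq => /eqP h.
  by rewrite h in ent.
have /choice[Ng NgP] : forall k, exists Ng : nat * (nat -> T -> R),
    [/\ (Ng.1%:R%:E <= packing_number F (M / 2 ^+ k)%R)%E,
    forall j, (j < Ng.1)%N -> F (Ng.2 j) &
    forall f, F f -> exists2 j, (j < Ng.1)%N &
      forall x, `|f x - Ng.2 j x| <= M / 2 ^+ k].
  move=> k; have [n [g ngP]] := packing_number_net (p k) FM (fin k).
  by exists (n, g).
(* At scale [M] the zero function alone covers [F], whether or not it belongs to [F]; its entropy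
   term is [ln 1 = 0]. *)
pose N k := if k is 0 then 1%N else (Ng k).1.
have N0 k : (0 < N k)%N.
  case: k => // k; have [_ _ cov] := NgP k.+1.
  by case: F0 => f /cov[j jn _]; exact: leq_ltn_trans jn.
exists N, (fun k j => if k is 0 then cst 0 else (Ng k).2 j); split => //.
- case=> [|k] j; first by left.
  by case: (NgP k.+1) => _ h _ jN; right; exact: h.
- move=> f [|k] Ff; last by case: (NgP k.+1) => _ _; exact.
  by exists 0 => // x; rewrite subr0 expr0 divr1 FM.
have NE k : ((Num.sqrt (ln (N k)%:R))%:E <= e (M / 2 ^+ k)%R)%E.
  have := N0 k; case: k => [|k] /= Nk; first by rewrite ln1 sqrtr0; exact: e0.
  have -> : (Num.sqrt (ln (Ng k.+1).1%:R))%:E =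
      (lne (Ng k.+1).1%:R%:E `^ 2^-1)%E :> \bar R.
    by rewrite lne_EFin ?ltr0n// poweR_EFin powR12_sqrt// ln_ge0// ler1n.
  by apply: e_le; [rewrite lee_fin ler1n|case: (NgP k.+1)].
move=> m; rewrite -lee_fin EFinM fineK; last first.
  rewrite ge0_fin_numE//; apply: integral_ge0 => t _; exact: poweR_ge0.
apply: le_trans (_ : _ <= 2%:E * \sum_(k < m) (M / 2 ^+ k / 2)%:E *
    e (M / 2 ^+ k)%R)%E _; last first.
  by apply: lee_wpmul2l => //; exact: dyad.
rewrite ge0_sume_distrr; last first.
  by move=> k _; rewrite mule_ge0// lee_fin divr_ge0// ltW.
rewrite -sumEFin; apply: lee_sum => k _.
rewrite muleA -EFinM mulrCA divff// mulr1 EFinM lee_wpmul2l// lee_fin; exact/ltW/p.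
Qed.

End packing.

(** * Compactness *)

(* Stated without a topology on [T]: a product of [pmetricType]s carries no
   [ptopologicalType] structure, so the continuous version below does not apply
   to the cost function. *)
Lemma measurable_open_preimage (T : pointedType) (G : set (set T))
    (R : realType) (f : T -> R) : (forall A, open A -> G (f @^-1` A)) ->
  measurable_fun [set: g_sigma_algebraType G] f.
Proof.
move=> fG; apply: (measurability _ (RGenOpens.measurableE R)).
move=> _ [_ [a [b ->]] <-]; rewrite setTI; apply: sub_sigma_algebra.
by apply: fG; exact: interval_open.
Qed.

Lemma continuous_measurable_borel (T : ptopologicalType) (R : realType)
  (f : T -> R) : continuous f -> measurable_fun [set: borel T] f.
Proof. by move=> /continuousP cf; exact: measurable_open_preimage. Qed.

Lemma near_uniform_dist (T : choiceType) (R : realType)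
    (f : {uniform T -> R}) (e : R) :
  0 < e -> nbhs f [set h : {uniform T -> R} | forall y, `|f y - h y| < e].
Proof.
move=> e0; apply/uniform_nbhs; exists [set xy | ball xy.1 e xy.2]; split.
  exact: (entourage_ball _ (PosNum e0)).
by move=> h fh y; exact: fh.
Qed.

Lemma continuous_argmax_nonempty (T : ptopologicalType) (R : realType)
    (f : T -> R) : compact [set: T] -> continuous f ->
  exists z, forall y, f y <= f z.
Proof.
move=> cT cf.
have [||z _ zP] := @compact_EVT_max T R f setT _ cT.
- by exists point.
- exact: continuous_subspaceT.
by exists z => y; apply: zP; rewrite inE.
Qed.

(** Each [f] in [F] is bounded by its maximum modulus, and this bound plus 1 serves a uniform
    neighbourhood of [f]; compactness of [F] makes one bound serve all. *)
Lemma compact_uniform_bounded (T : ptopologicalType) (R : realType)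
    (F : set (T -> R)) :
  compact [set: T] -> (forall f, F f -> continuous f) ->
  compact (F : set {uniform T -> R}) ->
  exists2 M, 0 < M & forall f x, F f -> `|f x| <= M.
Proof.
move=> cT Fc /compact_near_coveringP Fcomp.
have := Fcomp R +oo (fun M (f : {uniform T -> R}) => forall x, `|f x| <= M) _.
have step (f : {uniform T -> R}) : F f ->
    \forall f' \near f & M \near +oo, forall x, `|f' x| <= M.
  move=> Ff; have cf : continuous (fun x => `|f x|).
    by move=> x; apply: cvg_norm; exact: Fc.
  have [z zP] := continuous_argmax_nonempty cT cf.
  exists ([set h : {uniform T -> R} | forall y, `|f y - h y| < 1],
          [set M : R | `|f z| + 1 <= M]).
    by split; [exact: near_uniform_dist|exact: nbhs_pinfty_ge].
  move=> [h M] [/= hf fM] x; apply: le_trans fM.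
  have -> : h x = f x - (f x - h x) by ring.
  by rewrite (le_trans (ler_normB _ _))// lerD// ltW.
move=> /(_ _ step) nearM.
have [M [M0 MP]] := filter_ex (filterI (nbhs_pinfty_gt (num_real 0)) nearM).
by exists M => // f x Ff; exact: MP.
Qed.

(** * The gap between mean and maximum *)

Section mean_below_max.
Context {R : realType} {T : pmetricType R} (c : T * T -> R)
  (F : set (T -> R)) (P : probability (borel T) R).
Hypothesis compactT : compact [set: T].
Hypothesis c_continuous : continuous c.
Hypothesis c_ge0 : forall z, 0 <= c z.
Hypothesis c_eq0 : forall x y, c (x, y) = 0 <-> x = y.
Hypothesis F_continuous : forall f, F f -> continuous f.
Hypothesis F_compact : compact (F : set {uniform T -> R}).
Hypothesis rho_crit_gt0 : (0 < critical_radius c F P)%E.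

(* The infimum is upper semicontinuous. *)
Let measurable_inf_cost (S : set T) : S !=set0 ->
  measurable_fun [set: borel T] (fun x => inf [set c (x, z) | z in S]).
Proof.
move=> S0; apply: (measurability _ (RGenInftyO.measurableE R)).
move=> _ [_ [a ->] <-]; rewrite setTI; apply: sub_sigma_algebra.
rewrite [X in open X](_ : _ =
  \bigcup_(z in S) (fun x => c (x, z)) @^-1` `]-oo, a[); last first.
  apply/seteqP; split => x; rewrite /= in_itv/=.
    move=> /inf_lt[|_ [z Sz <-] cza]; last by exists z => //=; rewrite in_itv.
    by case: S0 => z Sz; exists (c (x, z)), z.
  move=> [z Sz]; rewrite /= in_itv/= => cza.
  apply: le_lt_trans cza; apply: ge_inf; last by exists z.
  by exists 0 => _ [y _ <-].
apply: bigcup_open => z _; apply: open_comp; last exact: interval_open.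
move=> x _; apply: (@continuous_comp _ _ _ (fun x => (x, z)) c);
  last exact: c_continuous.
by apply: cvg_pair => //; exact: cvg_cst.
Qed.

Lemma mean_lt_max f : F f -> exists z, \int[P]_x f x < f z.
Proof.
move=> Ff; apply: contrapT => /forallNP nz.
have cf := F_continuous Ff.
have [z0 z0max] := continuous_argmax_nonempty compactT cf.
have [M M0 FM] := compact_uniform_bounded compactT F_continuous F_compact.
have mf : measurable_fun [set: borel T] f by exact: continuous_measurable_borel.
have fM x : `|f x| <= M by exact: FM.
set m := \int[P]_x f x in nz.
have fm x : f x <= m by rewrite leNgt; apply/negP.
pose phi x := inf [set c (x, z) | z in argmax f].
have mphi : measurable_fun [set: borel T] phi.
  by apply: measurable_inf_cost; exists z0.
(* Nonnegative with integral 0, hence null almost everywhere: [P]-almost every point maximises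
   [f]. *)
pose g x : \bar R := (m - f x)%:E.
have mg : measurable_fun [set: borel T] g.
  by apply/measurable_EFinP; apply: measurable_funB => //; exact: measurable_cst.
have g0 x : (0 <= g x)%E by rewrite lee_fin subr_ge0.
have intg : (\int[P]_x `|g x| = 0)%E.
  under eq_integral do rewrite gee0_abs//.
  have gb x : `|m - f x| <= `|m| + M.
    by rewrite (le_trans (ler_normB _ _))// lerD.
  rewrite -(EFin_Rintegral_bounded P _ gb); last first.
    by apply: measurable_funB => //; exact: measurable_cst.
  rewrite RintegralB//; last exact: integrable_bounded mf fM.
    by rewrite Rintegral_cst_probability subrr.
  exact: finite_measure_integrable_cst.
have ae0 : ae_eq P setT g (cst 0%E) by apply/ae_eq_integral_abs.
have aephi : ae_eq P setT (EFin \o phi) (cst 0%E).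
  move: ae0; apply: filterS => x /(_ Logic.I) /= [] /eqP.
  rewrite subr_eq0 => /eqP mfx _; congr EFin.
  have xmax : argmax f x by move=> y; rewrite -mfx.
  apply/eqP; rewrite eq_le; apply/andP; split.
    apply: ge_inf; first by exists 0 => _ [y _ <-].
    by exists x => //; apply/c_eq0.
  by apply: lb_le_inf; [exists (c (x, x)), x|move=> _ [y _ <-]].
move: rho_crit_gt0; rewrite ltNge => /negP; apply.
apply: (@le_trans _ _ (\int[P]_x (phi x)%:E)%E).
  by apply: ereal_inf_lbound; exists f.
suff -> : (\int[P]_x (phi x)%:E = \int[P]_x (cst 0 x))%E by rewrite integral0.
by apply: ae_eq_integral => //; exact/measurable_EFinP.
Qed.

Lemma mean_uniformly_below_max :
  exists2 kappa, 0 < kappa & forall f, F f ->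
    exists z, \int[P]_x f x + kappa <= f z.
Proof.
have [M M0 FM] := compact_uniform_bounded compactT F_continuous F_compact.
have mF f : F f -> measurable_fun [set: borel T] f.
  by move=> /F_continuous; exact: continuous_measurable_borel.
move/compact_near_coveringP : F_compact => Fcov.
have := Fcov R 0^'+ (fun e (f : {uniform T -> R}) =>
  F f -> exists z, \int[P]_x f x + e <= f z) _.
have step (f : {uniform T -> R}) : F f -> \forall f' \near f & e \near 0^'+,
    F f' -> exists z, \int[P]_x f' x + e <= f' z.
  move=> Ff; have [z fz] := mean_lt_max Ff.
  (* One third of the gap at [f] for each loss: the change of the mean, the change of the value at
     [z], and the margin [e] itself. *)
  pose e0 := (f z - \int[P]_x f x) / 3.
  have e00 : 0 < e0 by rewrite divr_gt0// subr_gt0.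
  exists ([set h : {uniform T -> R} | forall y, `|f y - h y| < e0],
          [set e : R | e <= e0]).
    by split; [exact: near_uniform_dist|exact: nbhs_right_le].
  move=> [h e] [/= hf ee0] Fh; exists z.
  have Ih : `|\int[P]_x (f x - h x)| <= e0.
    apply: norm_Rintegral_bounded => [|x]; last exact: ltW.
    by apply: measurable_funB; exact: mF.
  rewrite RintegralB// in Ih; last 2 first.
  - by apply: integrable_bounded (mF _ Ff) (fun x => FM f x Ff).
  - by apply: integrable_bounded (mF _ Fh) (fun x => FM h x Fh).
  have := hf z; rewrite /e0 ltr_norml => /andP[_ h1].
  move: Ih ee0; rewrite /e0 ler_norml => /andP[h2 _] h3; lra.
move=> /(_ _ step) neare.
have [e [e0 eP]] := filter_ex (filterI (nbhs_right_gt (0 : R)) neare).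
by exists e => // f Ff; exact: eP.
Qed.

End mean_below_max.

(** * Lower bound on the robust risk *)

Section discrete_probability.
Local Open Scope ereal_scope.
Context {d : measure_display} {T : measurableType d} {R : realType}.

Lemma discrete_measure (s : seq (R * T)) : all (fun p => 0 <= p.1)%R s ->
  exists m : {measure set T -> \bar R},
    (forall A, m A = \sum_(p <- s) p.1%:E * \d_(p.2) A) /\
    (forall f : T -> R, measurable_fun setT f -> (forall x, 0 <= f x)%R ->
      \int[m]_x (f x)%:E = (\sum_(p <- s) p.1 * f p.2)%R%:E).
Proof.
elim: s => [_|[w x] s IH /= /andP[w0 s0]].
  exists mzero; split; first by move=> A; rewrite big_nil.
  by move=> f mf f0; rewrite integral_measure_zero big_nil.
have [m [mE mint]] := IH s0.
exists (measure_add (mscale (NngNum w0) (dirac x)) m); split.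
  by move=> A; rewrite big_cons -mE; exact: measure_addE.
move=> f mf f0; have mEf : measurable_fun setT (fun x => (f x)%:E).
  exact/measurable_EFinP.
have Ef0 x0 : setT x0 -> 0 <= (f x0)%:E by rewrite lee_fin f0.
rewrite ge0_integral_measure_add//.
rewrite [in RHS]big_cons EFinD EFinM /=; congr (_ + _); last exact: mint.
transitivity (w%:E * \int[\d_x]_y (f y)%:E); 
  first by apply: ge0_integral_mscale.
by rewrite integral_dirac// diracT mul1e.
Qed.

Lemma discrete_probability (s : seq (R * T)) (x0 : T) :
  all (fun p => 0 <= p.1)%R s -> (\sum_(p <- s) p.1 = 1)%R ->
  exists Q : probability T R,
    (forall A, Q A = \sum_(p <- s) p.1%:E * \d_(p.2) A) /\
    (forall (f : T -> R) (b : R), measurable_fun setT f ->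
      (forall x, `|f x| <= b)%R ->
      \int[Q]_x (f x)%:E = (\sum_(p <- s) p.1 * f p.2)%R%:E).
Proof.
move=> s0 s1; have [m [mE mint]] := discrete_measure s0.
have m1 : m setT = 1.
  rewrite mE; under eq_bigr do rewrite diracT mule1.
  by rewrite sumEFin s1.
(* As [m] has mass 1, normalising leaves its values unchanged and only supplies the probability
   structure; [dirac x0] is the fallback for degenerate masses. *)
pose Q : probability T R := mnormalize m (dirac x0); exists Q.
have QE A : Q A = m A.
  by rewrite /Q/= /mnormalize m1 onee_eq0/= invr1 mule1.
split; first by move=> A; rewrite -mE.
move=> f b mf fb.
(* The shift by [b] reduces to nonnegative functions; it is subtracted at the end because the
   weights sum to 1. *)
have mfb : measurable_fun setT (fun x => f x + b)%R.
  by apply: measurable_funD => //; exact: measurable_cst.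
have fb0 x : (0 <= f x + b)%R.
  by rewrite -lerBlDr sub0r; have := fb x; rewrite ler_norml => /andP[].
have bb x : (`|f x + b| <= b + `|b|)%R by rewrite (le_trans (ler_normD _ _))// lerD.
rewrite -(EFin_Rintegral_bounded Q mf fb); congr EFin.
have : \int[Q]_x (f x + b)%:E = (\sum_(p <- s) p.1 * (f p.2 + b))%R%:E.
  rewrite -(mint (fun x => f x + b)%R)//.
  by apply: eq_measure_integral => A mA _; exact: QE.
rewrite -(EFin_Rintegral_bounded Q mfb bb) => -[].
rewrite RintegralD//; last 2 first.
- exact: integrable_bounded mf fb.
- exact: finite_measure_integrable_cst.
rewrite Rintegral_cst_probability.
under [in RHS]eq_bigr do rewrite mulrDr.
by rewrite big_split/= -mulr_suml s1 mul1r => /addIr.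
Qed.

End discrete_probability.

(* The plan moves a fraction [theta] of every atom of the empirical measure to
   [z]. *)
Lemma robust_risk_ge_mixture (R : realType) (T : pmetricType R)
    (c : T * T -> R) (f : T -> R) (B C rho theta : R) (n : nat)
    (xi : 'I_n -> T) (z : T) :
  continuous c -> (forall x, 0 <= c x) -> (forall x, c (x, x) = 0) ->
  (forall x, c x <= C) -> continuous f -> (forall x, `|f x| <= B) ->
  (0 < n)%N -> 0 <= theta <= 1 -> theta * C <= rho ->
  (((1 - theta) * (n%:R^-1 * \sum_(i < n) f (xi i)) + theta * f z)%:E <=
    robust_risk c rho (empirical xi) f)%E.
Proof.
move=> cc c0 cxx cC cf fB n0 /andP[t0 t1] tC.
have nn0 : n%:R != 0 :> R by rewrite pnatr_eq0 -lt0n.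
have mf : measurable_fun [set: borel T] f by exact: continuous_measurable_borel.
have mc : measurable_fun [set: borel (T * T)%type] c.
  by move/continuousP : cc => cc; exact: measurable_open_preimage.
pose s : seq (R * (T * T)) :=
  [seq ((1 - theta) / n%:R, (xi i, xi i)) | i <- index_enum 'I_n] ++
  [seq (theta / n%:R, (xi i, z)) | i <- index_enum 'I_n].
have sumE (V : nmodType) (g : R * (T * T) -> V) : \sum_(p <- s) g p =
    \sum_(i < n) g ((1 - theta) / n%:R, (xi i, xi i)) +
    \sum_(i < n) g (theta / n%:R, (xi i, z)).
  by rewrite big_cat/= !big_map.
have s0 : all (fun p => 0 <= p.1) s.
  apply/allP => p; rewrite mem_cat => /orP[] /mapP[i _ ->] /=;
  by rewrite divr_ge0// subr_ge0.
have s1 : \sum_(p <- s) p.1 = 1.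
  rewrite (sumE _ (fun p => p.1)) /=.
  rewrite !sumr_const card_ord.
  by rewrite -(mulr_natr ((1 - theta) / _)) -(mulr_natr (theta / _)); field.
have [pi [piE piint]] :=
  @discrete_probability _ (borel (T * T)%type) R s (z, z) s0 s1.
(* Projecting the atoms of the plan to the second coordinate makes [Q] its second marginal. *)
pose s' : seq (R * T) := [seq (p.1, p.2.2) | p <- s].
have s'0 : all (fun p => 0 <= p.1) s' by rewrite all_map.
have s'1 : \sum_(p <- s') p.1 = 1 by rewrite big_map.
have [Q [QE Qint]] := @discrete_probability _ (borel T) R s' z s'0 s'1.
have diracX (x y : T) A : \d_((x, y) : borel (T * T)%type) (fst @^-1` A) =
    \d_(x : borel T) A :> \bar R.
  by rewrite !diracE; congr (_%:R%:E); apply/idP/idP; rewrite !inE.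
have diracY (x y : T) A : \d_((x, y) : borel (T * T)%type) (snd @^-1` A) =
    \d_(y : borel T) A :> \bar R.
  by rewrite !diracE; congr (_%:R%:E); apply/idP/idP; rewrite !inE.
apply: (@le_trans _ _ (\int[Q]_x (f x)%:E)%E).
  rewrite (Qint _ _ mf fB) lee_fin big_map sumE /=.
  rewrite -!mulr_sumr sumr_const card_ord -mulr_natr.
  by rewrite le_eqVlt; apply/orP; left; apply/eqP; field.
apply: ereal_sup_ubound; exists Q => //=.
apply: (@le_trans _ _ (\int[pi]_x (c x)%:E)%E).
  apply: ereal_inf_lbound; exists pi => //; split => A mA.
    rewrite piE sumE /= /empirical ge0_sume_distrr// -big_split/=.
    apply: eq_bigr => i _; rewrite !diracX diracE -!EFinM -EFinD.
    by congr EFin; field.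
  rewrite piE; apply: esym; apply: etrans (QE A) _; rewrite big_map.
  by apply: eq_bigr => -[w [x y]] _ /=; rewrite diracY.
rewrite (piint _ C mc) => [|x]; last by rewrite ger0_norm.
rewrite lee_fin sumE /= big1 ?add0r => [|i _]; last by rewrite cxx mulr0.
apply: le_trans tC; rewrite -mulr_sumr -mulrA ler_wpM2l//.
rewrite mulrC ler_pdivrMr ?ltr0n//.
rewrite (le_trans (ler_sum _ (fun i _ => cC (xi i, z))))//.
by rewrite sumr_const card_ord mulr_natr.
Qed.

(** * Choice of the constants and conclusion *)

Theorem theorem3p1 (R : realType) (T : pmetricType R) (c : T * T -> R)
    (F : set (T -> R)) (P : probability (borel T) R)
    (compactT : compact [set: T])
    (c_continuous : continuous c)
    (c_ge0 : forall z, 0 <= c z)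
    (c_eq0 : forall x y, c (x, y) = 0 <-> x = y)
    (F_continuous : forall f, F f -> continuous f)
    (F_compact : compact (F : set {uniform T -> R}))
    (F_dudley : (dudley_entropy F < +oo)%E)
    (rho_crit_gt0 : (0 < critical_radius c F P)%E) :
  let I_F := fine (dudley_entropy F) in
  let normF := supnorm_family F in
  let rho_crit := fine (critical_radius c F P) in
  exists lambda_low : R, 0 < lambda_low /\
  forall delta : R, 0 < delta < 1 ->
  let alpha :=
    48 * (normF + 1 / lambda_low) * (I_F + 2 / lambda_low)
    + 2 * normF / lambda_low * Num.sqrt (2 * ln (2 / delta)) in
  let beta :=
    96 * I_F / lambda_low
    + 4 * normF / lambda_low * Num.sqrt (2 * ln (4 / delta)) in
  forall (n : nat) (rho : R),
  n%:R > 16 * (alpha + beta) ^+ 2 / rho_crit ^+ 2 ->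
  rho > alpha / Num.sqrt n%:R ->
  forall (d : measure_display) (Omega : measurableType d)
    (Pr : probability Omega R) (xi : 'I_n -> {RV Pr >-> borel T}),
  iid_samples P xi ->
  with_probability_at_least Pr (1 - delta)
    [set w | forall f, F f ->
       (robust_risk c rho (empirical (fun i => xi i w)) f
        >= \int[P]_x (f x)%:E)%E].
Proof.
move=> I_F normF rho_crit.
have [F0|/set0P F0] := eqVneq F set0.
  exists 1; split => // delta /andP[d0 _] alpha beta n rho _ _ d Omega Pr xi _.
  exists setT; split => //.
    by move=> w _ f; rewrite F0.
  by rewrite [leRHS]probability_setT lee_fin; lra.
have [M M0 FM] := compact_uniform_bounded compactT F_continuous F_compact.
have [kappa kappa0 Fkappa] := mean_uniformly_below_max compactT c_continuous
  c_ge0 c_eq0 F_continuous F_compact rho_crit_gt0.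
have mF f : F f -> measurable_fun [set: borel T] f.
  by move=> /F_continuous; exact: continuous_measurable_borel.
have [C C0 cC] : exists2 C, 0 < C & forall x, c x <= C.
  have cTT : compact [set: T * T] by rewrite -setXTT; exact: compact_setX.
  have [||z _ zP] := @compact_EVT_max (T * T)%type R c setT _ cTT.
  - by exists (point, point).
  - exact: continuous_subspaceT.
  exists (c z + 1) => [|x]; first by rewrite ltr_wpDl.
  by rewrite (le_trans (zP _ _)) ?inE// lerDl.
have [N [net [N0 net0 netF net_cover net_ent]]] := dyadic_nets M0 F0 FM F_dudley.
have mnet k j : (j < N k)%N -> measurable_fun [set: borel T] (net k j).
  by move=> /netF[->|/mF//]; exact: measurable_cst.
have I_F0 : 0 <= I_F.
  by apply: fine_ge0; apply: integral_ge0 => t _; exact: poweR_ge0.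
have FnormF f x : F f -> `|f x| <= normF.
  move=> Ff; apply: (le_trans (ler_supnorm x (fun y => FM f y Ff))).
  apply: ub_le_sup; last by exists f.
  by exists M => _ [g Fg <-]; apply: supnorm_le => y; exact: FM.
(* Mean and values of [f] both lie within [normF] of 0, so the gap [kappa] forces [normF > 0]; [l]
   below divides by it. *)
have normF0 : 0 < normF.
  have [f Ff] := F0; have [z fz] := Fkappa f Ff.
  have := FnormF f z Ff; rewrite ler_norml => /andP[_ h1].
  have := norm_Rintegral_bounded P (mF f Ff) (fun x => FnormF f x Ff).
  rewrite ler_norml => /andP[h2 _]; lra.
(* [K1 + K2 * L] is the numerator in [chaining] with [A = 2 * I_F]. *)
have [K1 K1E K10] : exists2 K1, K1 = 12 * (3 * (2 * I_F) + 4 * M) & 0 <= K1.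
  by eexists; [reflexivity|rewrite mulr_ge0// addr_ge0// !mulr_ge0// ltW].
have [K2 K2E K20] : exists2 K2, K2 = 24 * M & 0 <= K2.
  by eexists; [reflexivity|rewrite mulr_ge0// ltW].
have [C_ge0 kappa_ge0 normF_ge0] := And3 (ltW C0) (ltW kappa0) (ltW normF0).
(* With [lambda_low = l^-1], [alpha] is at least [l + normF * l * L]. *)
pose l := 1 + K1 * C / kappa + K2 * C / (kappa * normF).
have l1 : 1 <= l.
  have := divr_ge0 (mulr_ge0 K10 C_ge0) kappa_ge0.
  have := divr_ge0 (mulr_ge0 K20 C_ge0) (mulr_ge0 kappa_ge0 normF_ge0).
  by rewrite /l; lra.
have l0 : 0 < l by exact: lt_le_trans l1.
exists l^-1; split; first by rewrite invr_gt0.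
move=> delta d01 alpha beta n rho n_big rho_big d Omega Pr xi [lawX indepX].
case/andP: (d01) => d0 d1.
pose L := Num.sqrt (ln (2 / delta)).
have L0 : 0 <= L by exact: sqrtr_ge0.
have n0 : (0 < n)%N.
  rewrite -(ltr_nat R); apply: le_lt_trans n_big.
  by rewrite divr_ge0 ?sqr_ge0// mulr_ge0 ?sqr_ge0.
have ln0 : 0 <= ln (2 / delta) by rewrite ln_ge0// ler_pdivlMr//; lra.
have L2 : L <= Num.sqrt (2 * ln (2 / delta)).
  by rewrite ler_sqrt ?mulr_ge0//; lra.
(* The first summand of [alpha] exceeds [l] because [l >= 1], and this pays for [K1]; the second
   exceeds [normF * l * L] and pays for [K2 * L]. *)
have alpha_ge : C * (K1 + K2 * L) <= kappa * alpha.
  have -> : alpha = 48 * (normF + l) * (I_F + 2 * l) +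
      2 * normF * l * Num.sqrt (2 * ln (2 / delta)).
    by rewrite /alpha div1r !invrK.
  have a1 : C * K1 <= kappa * l.
    rewrite /l !mulrDr.
    have -> : kappa * (K1 * C / kappa) = C * K1 by field; rewrite gt_eqF.
    have : 0 <= kappa * 1 by rewrite mulr_ge0// ltW.
    have : 0 <= kappa * (K2 * C / (kappa * normF)).
      by rewrite mulr_ge0 ?divr_ge0 ?mulr_ge0// ltW.
    lra.
  have a2 : C * K2 <= kappa * normF * l.
    rewrite /l !mulrDr.
    have -> : kappa * normF * (K2 * C / (kappa * normF)) = C * K2.
      by field; rewrite !gt_eqF.
    have : 0 <= kappa * normF * 1 by rewrite !mulr_ge0// ltW.
    have : 0 <= kappa * normF * (K1 * C / kappa).
      by rewrite !mulr_ge0 ?invr_ge0// ltW.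
    lra.
  have b1 : l <= 48 * (normF + l) * (I_F + 2 * l).
    have : 0 <= normF * I_F by rewrite mulr_ge0// ltW.
    have : 0 <= normF * l by rewrite mulr_ge0// ltW.
    have : 0 <= l * I_F by rewrite mulr_ge0// ltW.
    nra.
  have b2 : normF * l * L <= 2 * normF * l * Num.sqrt (2 * ln (2 / delta)).
    have nl0 : 0 <= normF * l by rewrite mulr_ge0// ltW.
    have := ler_wpM2l nl0 L2.
    have : 0 <= normF * l * L by rewrite mulr_ge0.
    lra.
  rewrite mulrDr [leRHS]mulrDr lerD//.
    by apply: (le_trans a1); rewrite ler_wpM2l// ltW.
  rewrite mulrA; apply: (@le_trans _ _ (kappa * normF * l * L)).
    by rewrite ler_wpM2r.
  by rewrite -!mulrA ler_wpM2l ?(ltW kappa0)// !mulrA.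
have sn0 : 0 < Num.sqrt (n%:R : R) by rewrite sqrtr_gt0 ltr0n.
have alpha0 : 0 <= alpha.
  rewrite -(pmulr_rge0 _ kappa0); apply: le_trans alpha_ge.
  by rewrite mulr_ge0 ?addr_ge0 ?mulr_ge0// ltW.
have rho0 : 0 < rho by apply: le_lt_trans rho_big; rewrite divr_ge0// ltW.
have [E [mE PrE EP]] := chaining n0 lawX indepX M0 mF mnet N0 net0
  net_cover net_ent d01.
exists E; split => // w Ew f Ff /=.
have fM x : `|f x| <= M by exact: FM.
have cf := F_continuous f Ff.
have cxx x : c (x, x) = 0 by apply/c_eq0.
have [z fz] := Fkappa f Ff.
rewrite -(EFin_Rintegral_bounded P (mF f Ff) fM).
set m := \int[P]_x f x in fz *.
set e := n%:R^-1 * \sum_(i < n) f (xi i w).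
have gap : m - e <= (K1 + K2 * L) / Num.sqrt n%:R.
  by rewrite K1E K2E; exact: EP.
have mix theta : 0 <= theta <= 1 -> theta * C <= rho ->
    m <= (1 - theta) * e + theta * f z ->
    (m%:E <= robust_risk c rho (empirical (fun i => xi i w)) f)%E.
  move=> t01 tC h; apply: le_trans (robust_risk_ge_mixture (fun i => xi i w) z
    c_continuous c_ge0 cxx cC cf fM n0 t01 tC).
  by rewrite lee_fin.
(* Three regimes: [theta = 0] if the sample does not underestimate the mean, [theta = 1] if the
   budget covers every transport, and [theta = rho / C] otherwise. *)
have [me|em] := leP m e.
  apply: (mix 0); first by rewrite lexx ler01.
    by rewrite mul0r ltW.
  by rewrite subr0 mul1r mul0r addr0.
have [Crho|rhoC] := leP C rho.
  apply: (mix 1); first by rewrite lexx ler01.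
    by rewrite mul1r.
  by rewrite subrr mul0r add0r mul1r; lra.
have t0 : 0 <= rho / C by rewrite divr_ge0 ?(ltW rho0).
apply: (mix (rho / C)).
- by rewrite t0 ler_pdivrMr// mul1r ltW.
- by rewrite divfK// gt_eqF.
(* As [e < m], moving mass to [z] gains at least [kappa] per unit, and the mixture equals
   [e + theta * (f z - e)]. *)
have h1 : rho / C * kappa <= rho / C * (f z - e) by rewrite ler_wpM2l//; lra.
suff : m - e <= rho / C * kappa by lra.
apply: (le_trans gap); apply: (@le_trans _ _ (alpha / Num.sqrt n%:R * (kappa / C))).
  rewrite mulrAC ler_wpM2r ?invr_ge0 ?(ltW sn0)//.
  by rewrite mulrA ler_pdivlMr// mulrC [alpha * _]mulrC.
have -> : rho / C * kappa = rho * (kappa / C) by rewrite mulrAC mulrA.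
by rewrite ler_wpM2r ?divr_ge0// ltW.
Qed.
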